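(* For every $\varepsilon>0$ there is a constant $c$ such that every finite tree $T$ with maximum degree $\Delta$ satisfies $\pi_l(T)\leq c\,\Delta^{1+\varepsilon}$.
   Context: A repetition is a sequence of the form $x_1\ldots x_h x_1\ldots x_h$ with $h\geq 1$. A coloring $f:V(G)\to\mathbb{N}$ of a graph $G$ is nonrepetitive if for every simple path $v_1v_2\ldots v_k$ in $G$, the color sequence $f(v_1),\ldots,f(v_k)$ contains no repetition as a block of consecutive terms. A list assignment of $G$ is a family $\{L_v\}_{v\in V(G)}$ of sets of colors; a coloring $f$ is chosen from $\{L_v\}$ if $f(v)\in L_v$ for all $v$. The Thue choice number $\pi_l(G)$ is the minimum $k$ such that for every list assignment $\{L_v\}$ of $G$ with $|L_v|\geq k$ for all $v$ there is a nonrepetitive coloring of $G$ chosen from $\{L_v\}$.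
   Formalization: The formal theorem assumes the maximum degree Δ is at least 1; this excludes only the one-vertex tree, for which Δ = 0 and π_l = 1, so the bound c·Δ^{1+ε} = 0 fails. *)

(* Defs.v *)
From HB Require Import structures.
From mathcomp Require Import all_boot all_order all_algebra.
From mathcomp Require Import all_classical all_reals all_analysis.

Set Implicit Arguments.
Unset Strict Implicit.
Unset Printing Implicit Defensive.

Local Open Scope nat_scope.
Local Open Scope classical_set_scope.
Local Open Scope card_scope.

Record sgraph := SGraph {
  vertex :> finType;
  adj : rel vertex;
  adj_sym : symmetric adj;
  adj_irr : irreflexive adj
}.

Definition degree (G : sgraph) (v : G) : nat := #|[pred u | adj v u]|.

Definition max_degree (G : sgraph) : nat := \max_(v : G) degree v.

Definition connected_graph (G : sgraph) : Prop :=
  0 < #|G| /\ forall u v : G, connect (@adj G) u v.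

(* The bound on the size rules out the closed walks u, v, u along an edge,
   which [cycle] accepts. *)
Definition acyclic_graph (G : sgraph) : Prop :=
  forall c : seq G, 2 < size c -> uniq c -> ~~ cycle (@adj G) c.

Definition is_tree (G : sgraph) : Prop := connected_graph G /\ acyclic_graph G.

(* [sorted] only relates consecutive terms, whether or not the relation is
   transitive. *)
Definition simple_path (G : sgraph) (p : seq G) : bool :=
  sorted (@adj G) p && uniq p.

Definition repetition (s : seq nat) : Prop :=
  exists x : seq nat, 0 < size x /\ s = x ++ x.

Definition nonrepetitive (G : sgraph) (f : G -> nat) : Prop :=
  forall p : seq G, simple_path p ->
  forall s : seq nat, infix s (map f p) -> ~ repetition s.

Definition chosen_from (G : sgraph) (L : G -> set nat) (f : G -> nat) : Prop :=
  forall v : G, L v (f v).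

(* [`I_k #<= A] means |A| >= k; the lists may be infinite. *)
Definition thue_choosable (G : sgraph) (k : nat) : Prop :=
  forall L : G -> set nat, (forall v : G, `I_k #<= L v) ->
  exists f : G -> nat, chosen_from L f /\ nonrepetitive f.

Lemma card_ge_notin (n : nat) (A : set nat) (s : seq nat) :
  `I_n #<= A -> size s < n -> exists2 a, A a & a \notin s.
Proof.
move=> /pcard_leP[g] ltsn; apply: contrapT => nex.
have gA i : i < n -> A (g i) by move=> ?; apply: funS.
suff : n <= size s by rewrite leqNgt ltsn.
rewrite -[n](size_iota 0) -(size_map g); apply: uniq_leq_size.
  rewrite map_inj_in_uniq ?iota_uniq // => i j.
  rewrite !mem_iota /= !add0n => lti ltj.
  by apply: (@inj _ _ _ g); rewrite inE.
move=> _ /mapP[i + ->]; rewrite mem_iota /= add0n => lti.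
by apply: contrapT => /negP gis; apply: nex; exists (g i) => //; apply: gA.
Qed.

Lemma exists_inj_choice (G : sgraph) (L : G -> set nat) (s : seq G) :
  (forall v : G, `I_(size s) #<= L v) -> uniq s ->
  exists f : G -> nat, (forall v, v \in s -> L v (f v)) /\ uniq (map f s).
Proof.
move=> hL; have := leqnn (size s).
elim: {1 3 4 5}s => [|v r IHr] /= ltr; first by exists (fun=> 0).
move=> /andP[vr ur]; have [f [fL fu]] := IHr (ltnW ltr) ur.
have [|a La ar] := card_ge_notin (s := map f r) (hL v); first by rewrite size_map.
exists (fun u => if u == v then a else f u).
have Er : map (fun u => if u == v then a else f u) r = map f r.
  by apply/eq_in_map => u ur'; case: eqP => // Eu; rewrite -Eu ur' in vr.
rewrite Er eqxx ar fu; split=> // u.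
by rewrite inE; case: eqP => [->|_] //= /fL.
Qed.

Lemma thue_choosable_card (G : sgraph) : thue_choosable G #|G|.
Proof.
move=> L; rewrite cardE => hL.
have [f [fL fu]] := exists_inj_choice hL (enum_uniq _).
exists f; split=> [v|p /andP[_ up] s sp [x [x0 Es]]].
  by apply: fL; rewrite mem_enum.
have finj : injective f by apply/injectiveP.
have up' : uniq (map f p).
  by rewrite map_inj_uniq.
move: (infix_uniq sp up'); rewrite Es cat_uniq.
by case: x x0 {Es} => //= a x _; rewrite inE eqxx /= andbF.
Qed.

Lemma exists_thue_choosable (G : sgraph) :
  exists k : nat, `[< thue_choosable G k >].
Proof. by exists #|G|; apply/asboolP; exact: thue_choosable_card. Qed.

Definition thue_choice_number (G : sgraph) : nat :=
  ex_minn (exists_thue_choosable G).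

(* Main.v *)
Require Import Defs.
From mathcomp Require Import all_boot all_order all_algebra.
From mathcomp Require Import all_classical all_reals all_analysis.
From mathcomp Require Import zify lra.

(* Root the tree, fix M large in terms of eps, and write D for the maximum
   degree. A repetition of half-length h on a path with peak p forces one of two
   patterns. If the shorter leg has m edges with h - m >= h / M, the longer leg
   carries a run of h / M agreements between vertices at distance h. Otherwise
   both legs have almost h edges, and about (1 - 2 / M) h agreements compare
   depth s of one leg with depth h - s of the other.

   The vertices are coloured in depth-first order, so that of two legs one is
   entirely coloured before the other; the list of v then has to serve only the
   partial patterns on the branch above v. Give such a pattern the weight q ^ r
   if r agreements are missing. A pattern survives the colouring of v for at most
   one colour, so the average over K colours of the total weight at v is at most
   1 / (K q) times the weight at the parent plus the weight of the patterns that
   start at v. There are at most D ^ h patterns of the second kind for given h,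
   so this starting weight is at most 1 already for 1 / q of order D ^ (1 + eps),
   and K q >= 2 keeps the total weight below 1, the weight of a completed
   pattern. *)

Set Implicit Arguments.
Unset Strict Implicit.
Unset Printing Implicit Defensive.
Import Order.TTheory GRing.Theory Num.Theory.

Local Open Scope nat_scope.

(** * Rootings of a tree *)

(* [par] is only meaningful at vertices of positive depth. *)
Record rooting (G : sgraph) := Rooting {
  par : G -> G;
  dep : G -> nat;
  dep_par : forall v, 0 < dep v -> (dep (par v)).+1 = dep v;
  par_adj : forall v, 0 < dep v -> adj v (par v);
  adj_par : forall u v, adj u v ->
    (0 < dep u /\ par u = v) \/ (0 < dep v /\ par v = u)
}.

Lemma dep_iter_par (V : Type) (par : V -> V) (dep : V -> nat) :
  (forall v, 0 < dep v -> (dep (par v)).+1 = dep v) ->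
  forall n v, n <= dep v -> dep (iter n par v) = dep v - n.
Proof.
move=> dp; elim=> [|n IHn] v ltn /=; first by rewrite subn0.
have := IHn v (ltnW ltn); have := dp (iter n par v); lia.
Qed.

(** The depth is the length of a shortest walk to [r]; the second vertex of such a walk is one step
    closer. *)
Lemma walk_depth (G : sgraph) (r : G) : (forall v : G, connect (@adj G) v r) ->
  exists d : G -> nat, (forall v, d v = 0 -> v = r) /\
    (forall v, 0 < d v -> exists u, adj v u && ((d u).+1 == d v)).
Proof.
move=> rC.
pose W (v : G) n := [exists p : n.-tuple G, path (@adj G) v p && (last v p == r)].
have exW v : exists n, W v n.
  have /connectP[p pP lp] := rC v; exists (size p); apply/existsP.
  by exists (in_tuple p); rewrite /= pP -lp eqxx.
exists (fun v => ex_minn (exW v)); split=> v.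
  case: ex_minnP => n /existsP[p /andP[_ /eqP <-]] _ n0.
  by move: p; rewrite n0 => p; rewrite tuple0.
case: ex_minnP => -[|n] // /existsP[p /andP[pP lp]] nmin _.
case: p pP lp => -[|u p] //= sp /andP[vu pP] lp.
exists u; rewrite vu /=; case: ex_minnP => m Wm mmin; rewrite eqSS eqn_leq.
apply/andP; split.
  by apply: mmin; apply/existsP; exists (Tuple (sp : size p == n)); rewrite /= pP lp.
move/existsP: Wm => [q /andP[qP lq]].
rewrite -ltnS; apply: nmin; apply/existsP.
by exists [tuple of u :: q]; rewrite /= vu qP lq.
Qed.

(** The ancestor chains of [u] and [v] up to their first meeting point close up with the edge [uv].
    Unless one of the two is the parent of the other, this is a cycle on at least three distinct
    vertices. *)
Lemma edge_of_acyclic (G : sgraph) (r : G) (par : G -> G) (dep : G -> nat) :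
  acyclic_graph G -> (forall v, dep v = 0 -> v = r) ->
  (forall v, 0 < dep v -> (dep (par v)).+1 = dep v) ->
  (forall v, 0 < dep v -> adj v (par v)) ->
  forall u v, adj u v -> (0 < dep u /\ par u = v) \/ (0 < dep v /\ par v = u).
Proof.
move=> acyc dep0 dp pa u v uv.
have dI := dep_iter_par dp.
pose P n := [exists j : 'I_(dep v).+1, (n <= dep u) && (iter n par u == iter j par v)].
have exP : exists n, P n.
  exists (dep u); apply/existsP; exists ord_max.
  have top x : iter (dep x) par x = r by apply: dep0; rewrite dI ?subnn.
  by rewrite leqnn /= !top eqxx.
case: (ex_minnP exP) => i /existsP[[j ltj] /andP[lei /eqP /= Eij]] imin.
have inj x n m : n <= dep x -> m <= dep x -> iter n par x = iter m par x -> n = m.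
  move=> ln lm /(congr1 dep); rewrite !dI //; lia.
(* The meeting point is listed in the first chain only. *)
pose c := traject par u i.+1 ++ rev (traject par v j).
have uc : uniq c.
  have tu x n : n <= (dep x).+1 -> uniq (traject par x n).
    move=> ln; apply/(uniqP x) => a b; rewrite !inE size_traject => la lb.
    by rewrite !nth_traject //; apply: inj; lia.
  rewrite cat_uniq rev_uniq !tu ?andbT //; last by lia.
  apply/hasPn => x; rewrite mem_rev => /trajectP[b ltb ->].
  apply/negP => /trajectP[a lta Eab].
  have : i <= a.
    apply: imin; apply/existsP; exists (Ordinal (ltn_trans ltb ltj)).
    by rewrite /= Eab eqxx andbT; lia.
  move=> leia; have Eai : a = i by lia.
  have Ebj : b = j by apply: (inj v); rewrite ?Eab ?Eai ?Eij //; lia.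
  by rewrite Ebj ltnn in ltb.
have tp x n : n <= dep x -> path (@adj G) x (traject par (par x) n).
  elim: n x => //= n IHn x ltn.
  rewrite pa /=; last by lia.
  by apply: IHn; have := dp x; lia.
have cc : cycle (@adj G) c.
  rewrite /c trajectS /= rcons_path cat_path tp //= last_cat.
  have lT x n : last x (traject par (par x) n) = iter n par x.
    by elim: n x => //= n IHn x; rewrite IHn -iterSr.
  have bT x n : belast x (traject par (par x) n) = traject par x n.
    by elim: n x => //= n IHn x; rewrite IHn.
  rewrite lT Eij -{1}bT -{1}lT rev_path; apply/andP; split.
    by rewrite (eq_path (e' := @adj G)) ?tp // => x y; rewrite adj_sym.
  case: j {ltj Eij c uc} => [|j]; first by rewrite adj_sym.
  by rewrite trajectS rev_cons last_rcons adj_sym.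
have := acyc c; rewrite cc uc size_cat size_rev !size_traject => /(_ _ isT) sc.
have {sc} : i.+1 + j <= 2 by rewrite leqNgt; apply/negP => /sc.
case: i lei Eij {imin c uc cc} => [|[|i]] lei Eij;
  case: j ltj Eij => [|[|j]] ltj //= Eij _.
- by move: uv; rewrite Eij adj_irr.
- by right; split.
- by left; split.
Qed.

Lemma tree_rooting (G : sgraph) : is_tree G -> inhabited (rooting G).
Proof.
move=> [[/card_gt0P[r _] con] acyc].
have [|d [d0 dS]] := @walk_depth G r; first by move=> v; exact: con.
pose p v := odflt v [pick u | adj v u && ((d u).+1 == d v)].
have pP v : 0 < d v -> adj v (p v) && ((d (p v)).+1 == d v).
  move=> /dS[u Hu]; rewrite /p; case: pickP => [//|/(_ u)].
  by rewrite Hu.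
have pa v : 0 < d v -> adj v (p v) by move=> /pP/andP[].
have dp v : 0 < d v -> (d (p v)).+1 = d v by move=> /pP/andP[_ /eqP].
constructor; apply: (@Rooting G p d) => //.
exact: (edge_of_acyclic acyc d0 dp pa).
Qed.

Lemma card_descendants (G : sgraph) (t : rooting G) (p : G) k :
  #|[pred w | (k <= dep t w) && (iter k (par t) w == p)]| <= max_degree G ^ k.
Proof.
elim: k p => [|k IHk] p.
  rewrite expn0 -(card1 p); apply: subset_leq_card; apply/fintype.subsetP => w.
  by rewrite !inE.
set A := [pred w | _].
pose C := [pred u | adj p u].
pose below u w := (k <= dep t w) && (iter k (par t) w == u).
pose B := [pred w | [exists u, (u \in C) && below u w]].
have sA : A \subset B.
  apply/fintype.subsetP => w; rewrite !inE => /andP[lk /eqP Ep].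
  apply/existsP; exists (iter k (par t) w); rewrite /below eqxx andbT inE.
  have := dep_iter_par (@dep_par _ t) (ltnW lk) => dk.
  rewrite (ltnW lk) andbT -Ep adj_sym; apply: par_adj; lia.
apply: leq_trans (subset_leq_card sA) _.
apply: (@leq_trans (\sum_(u in C) max_degree G ^ k)); last first.
  rewrite sum_nat_const expnS leq_mul2r; apply/orP; right.
  exact: (leq_bigmax (F := @degree G)).
apply: (@leq_trans (\sum_(u in C) #|[pred w | below u w]|)).
  rewrite -sum1_card.
  under [X in _ <= X]eq_bigr do rewrite -sum1_card.
  rewrite (exchange_big_dep predT) //= [X in _ <= X](bigID B) /=.
  apply: leq_trans (leq_addr _ _).
  apply: leq_sum => w /existsP[u Hu].
  by rewrite (bigD1 u).
by apply: leq_sum => u _; exact: IHk.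
Qed.

(** * Depth-first order, and paths in the rooted tree *)

Fixpoint branch_rec (V : finType) (par : V -> V) n (v : V) : seq nat :=
  if n is m.+1 then rcons (branch_rec par m (par v)) (enum_rank v)
  else [:: enum_rank v : nat].

(** The path from the root down to [v], coded by numbers; the lexicographic order of these codes is
    the preorder of the tree. *)
Definition branch (G : sgraph) (t : rooting G) (v : G) : seqlexi nat :=
  branch_rec (par t) (dep t v) v.

Definition dfs_rank (G : sgraph) (t : rooting G) (v : G) : nat :=
  #|[pred u | (branch t u < branch t v)%O]|.

Lemma branch_par (G : sgraph) (t : rooting G) v : 0 < dep t v ->
  branch t v = rcons (branch t (par t v)) (enum_rank v : nat).
Proof. by move=> d0; rewrite /branch -(dep_par d0). Qed.

Lemma branch_iter (G : sgraph) (t : rooting G) n v : n <= dep t v ->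
  exists s, branch t v = branch t (iter n (par t) v) ++ s.
Proof.
elim: n => [|n IHn] len; first by exists [::]; rewrite cats0.
have [s ->] := IHn (ltnW len); rewrite /= branch_par.
  by rewrite cat_rcons; eexists.
by rewrite (dep_iter_par (@dep_par _ t)) ?subn_gt0 // ltnW.
Qed.

Lemma last_branch (G : sgraph) (t : rooting G) v :
  last 0 (branch t v) = enum_rank v.
Proof. by rewrite /branch; case: (dep t v) => //= n; rewrite last_rcons. Qed.

Lemma branch_inj (G : sgraph) (t : rooting G) : injective (branch t).
Proof.
move=> u v /(congr1 (last 0)); rewrite !last_branch => /val_inj.
exact: enum_rank_inj.
Qed.

Lemma ltxi_cat (w s1 s2 : seq nat) :
  ((w ++ s1 : seqlexi nat) < (w ++ s2 : seqlexi nat))%O =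
  ((s1 : seqlexi nat) < (s2 : seqlexi nat))%O.
Proof. by elim: w => //= x w IHw; rewrite ltxi_cons lexx. Qed.

Lemma dfs_rank_lt (G : sgraph) (t : rooting G) u v :
  (dfs_rank t u < dfs_rank t v) = (branch t u < branch t v)%O.
Proof.
have mono x y : (branch t x < branch t y)%O -> dfs_rank t x < dfs_rank t y.
  move=> xy; apply: proper_card; apply/properP; split.
    by apply/fintype.subsetP => z; rewrite !inE => zx; apply: lt_trans xy.
  by exists x; rewrite inE // ltxx.
apply/idP/idP => [|/mono//]; case: ltgtP => // [/mono vu uv|/branch_inj ->].
  by have := ltn_trans uv vu; rewrite ltnn.
by rewrite ltnn.
Qed.

Lemma dfs_rank_inj (G : sgraph) (t : rooting G) : injective (dfs_rank t).
Proof.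
move=> u v Euv; apply: (branch_inj (t := t)).
have := dfs_rank_lt t u v; have := dfs_rank_lt t v u.
by rewrite Euv ltnn; case: ltgtP.
Qed.

Lemma dfs_rank_ancestor (G : sgraph) (t : rooting G) n v :
  0 < n <= dep t v -> dfs_rank t (iter n (par t) v) < dfs_rank t v.
Proof.
move=> /andP[n0 nd]; rewrite dfs_rank_lt.
have [s Es] := branch_iter nd; rewrite Es -{1}[branch t _]cats0 ltxi_cat.
case: s Es => // /(congr1 (last 0)); rewrite cats0 !last_branch => /val_inj.
move=> /enum_rank_inj /(congr1 (dep t)).
by rewrite (dep_iter_par (@dep_par _ t)) //; lia.
Qed.

(* Depth-first order: of two sibling subtrees, one wholly precedes the other. *)
Lemma dfs_rank_subtrees (G : sgraph) (t : rooting G) m n v w :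
  m < dep t v -> n < dep t w ->
  iter m.+1 (par t) v = iter n.+1 (par t) w ->
  dfs_rank t (iter n (par t) w) < dfs_rank t (iter m (par t) v) ->
  dfs_rank t w < dfs_rank t v.
Proof.
move=> mv nw Ep; rewrite !dfs_rank_lt.
have dI := dep_iter_par (@dep_par _ t).
have [s ->] := branch_iter (ltnW mv); have [s' ->] := branch_iter (ltnW nw).
have dv : 0 < dep t (iter m (par t) v) by rewrite dI ?subn_gt0 // ltnW.
have dw : 0 < dep t (iter n (par t) w) by rewrite dI ?subn_gt0 // ltnW.
rewrite (branch_par dv) (branch_par dw) !cat_rcons -!cats1 -!iterS Ep.
rewrite !ltxi_cat !ltxi_cons => /andP[-> /=].
by rewrite ltxx implybF => /negbTE ->.
Qed.

(** A path cannot turn from descending to ascending: the lowest vertex of the turn would have its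
    parent both before and after it. *)
Lemma path_peak (G : sgraph) (t : rooting G) (x0 : G) (p : seq G) :
  simple_path p -> 0 < size p ->
  exists2 i, i < size p &
    (forall k, k < i -> 0 < dep t (nth x0 p k) /\
       par t (nth x0 p k) = nth x0 p k.+1) /\
    (forall k, i <= k -> k.+1 < size p -> 0 < dep t (nth x0 p k.+1) /\
       par t (nth x0 p k.+1) = nth x0 p k).
Proof.
rewrite /simple_path; elim: p => // x [|y p] IHp /andP[sp up] _.
  by exists 0.
have [|//|i lti [upi dni]] := IHp _.
  by move: sp up; rewrite /= => /andP[_ ->] /andP[_ ->].
have /andP[xy _] := sp.
have [[dx Ex]|[dy Ey]] := adj_par t xy.
  exists i.+1 => //; split.
    by case=> [|k] //= lk; apply: upi.
  by case=> [|k] //= lk; apply: dni.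
have i0 : i = 0.
  case: i lti upi {dni} => // i lti /(_ 0 isT)[_ /= E1]; exfalso.
  move: up; rewrite cons_uniq -Ey /= E1; case: p lti {IHp sp dy E1 Ey} => //= z p _.
  by rewrite !inE eqxx orbT.
exists 0 => //; split=> // -[|k] _ lk //.
by apply: (dni k); rewrite ?i0.
Qed.

(** * Greedy colouring controlled by a weight *)

Section GreedyColouring.

Variables (V X : finType) (par : V -> V) (rank : V -> nat).
Variables (start : V -> X -> nat -> bool) (mate : V -> X -> nat -> V).

(* Alignment [x] has its matches [0], ..., [j] realised at [v] and at the [j]
   vertices above [v]. *)
Fixpoint matched (f : V -> nat) (x : X) (j : nat) (v : V) : bool :=
  [&& start v x j, f v == f (mate v x j) &
      if j is i.+1 then matched f x i (par v) else true].

Lemma matched_intro (f : V -> nat) x j v :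
  (forall k, k <= j -> start (iter k par v) x (j - k) /\
     f (iter k par v) = f (mate (iter k par v) x (j - k))) ->
  matched f x j v.
Proof.
elim: j v => [|j IHj] v H /=; have [/= -> ->] := H 0 isT; rewrite ?eqxx //=.
by apply: IHj => k lek; have := H k.+1 lek; rewrite iterSr subSS.
Qed.

Variables (R : realFieldType) (q : R) (n : X -> nat) (K : nat).

(** Term [j] has [j.+1] matches realised and [n x - j.+1] missing. A completed alignment alone
    contributes [1], so danger below [1] excludes it. *)
Definition danger (f : V -> nat) (v : V) : R :=
  (\sum_(x : X) \sum_(j < n x) (matched f x j v)%:R * q ^+ (n x - j.+1))%R.

Hypothesis rank_inj : injective rank.
Hypothesis mate_lt : forall v x j, start v x j -> rank (mate v x j) < rank v.
Hypothesis par_lt : forall v x j, start v x j.+1 -> rank (par v) < rank v.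
Hypothesis n_gt0 : forall x, 0 < n x.
Hypothesis q_gt0 : (0 < q)%R.
Hypothesis Kq : (2 <= K%:R * q)%R.
Hypothesis new_le1 : forall v, (\sum_(x | start v x 0) q ^+ n x <= 1)%R.

Lemma matched_ext (f g : V -> nat) x j v :
  (forall u, rank u <= rank v -> f u = g u) -> matched f x j v = matched g x j v.
Proof.
elim: j v => [|j IHj] v fg /=; case s: (start v x _) => //=.
  by rewrite !fg // ltnW ?mate_lt.
rewrite (fg v) // (fg (mate _ _ _)) ?(ltnW (mate_lt s)) // IHj // => u ltu.
by apply: fg; rewrite (leq_trans ltu) // ltnW // (par_lt s).
Qed.

Lemma danger_ext (f g : V -> nat) v :
  (forall u, rank u <= rank v -> f u = g u) -> danger f v = danger g v.
Proof.
move=> fg; apply: eq_bigr => x _; apply: eq_bigr => j _.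
by rewrite (matched_ext _ _ fg).
Qed.

Lemma danger_ge0 f v : (0 <= danger f v)%R.
Proof.
apply: sumr_ge0 => x _; apply: sumr_ge0 => j _.
by rewrite mulr_ge0 ?ler0n // exprn_ge0 // ltW.
Qed.

Definition recolour (f : V -> nat) v a u := if u == v then a else f u.

(* A started alignment survives the colouring of [v] for at most one colour,
   and then its weight grows by a factor [1 / q]. *)
Lemma sum_danger_recolour f v (l : seq nat) : uniq l ->
  (q * (\sum_(a <- l) danger (recolour f v a) v) <=
   1 + (if (rank (par v) < rank v)%N then danger f (par v) else 0))%R.
Proof.
move=> ul.
(* All that [matched] asks for at [v] except that the colour of [v] be that of its mate. *)
pose pre x j :=
  start v x j && (if j is i.+1 then matched f x i (par v) else true).
have one x (j : 'I_(n x)) :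
    (\sum_(a <- l) (matched (recolour f v a) x j v)%:R <= (pre x j)%:R :> R)%R.
  have le1 (a : nat) : matched (recolour f v a) x j v =
      pre x j && (a == f (mate v x j)).
    have sE : start v x j -> recolour f v a (mate v x j) = f (mate v x j).
      move=> /mate_lt lt; rewrite /recolour; case: eqP => // E.
      by rewrite E ltnn in lt.
    rewrite /pre; case: (nat_of_ord j) sE => [|i] sE /=.
      case s: (start v x 0) => //=.
      by rewrite sE // {1}/recolour eqxx andbT.
    case s: (start v x i.+1) => //=.
    rewrite sE // {1}/recolour eqxx andbC; congr (_ && _).
    apply: matched_ext => u leu; rewrite /recolour; case: eqP => // E.
    by have := par_lt s; rewrite -{2}E ltnNge leu.
  under eq_bigr => a _ do rewrite le1 -mulnb natrM.
  rewrite -mulr_sumr -[leRHS]mulr1 ler_wpM2l ?ler0n //.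
  rewrite -natr_sum lern1.
  rewrite (_ : (\sum_(a <- l) _)%N = count_mem (f (mate v x j)) l).
    by rewrite count_uniq_mem // leq_b1.
  by elim: (l) => [|a l' IHl]; rewrite ?big_nil // big_cons IHl.
have -> : (\sum_(a <- l) danger (recolour f v a) v =
    \sum_(x : X) \sum_(j < n x)
      (\sum_(a <- l) (matched (recolour f v a) x j v)%:R) * q ^+ (n x - j.+1))%R.
  rewrite exchange_big /=; apply: eq_bigr => x _.
  rewrite exchange_big /=; apply: eq_bigr => j _.
  by rewrite mulr_suml.
apply: (@le_trans _ _ (\sum_(x : X) \sum_(j < n x) (pre x j)%:R * q ^+ (n x - j))%R).
  rewrite mulr_sumr; apply: ler_sum => x _.
  rewrite mulr_sumr; apply: ler_sum => j _.
  rewrite mulrCA -exprS subnSK //.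
  by apply: ler_wpM2r; rewrite ?one // exprn_ge0 // ltW.
apply: le_trans (lerD (new_le1 v) (lexx _)).
rewrite [X in (_ <= X + _)%R]big_mkcond /=.
have q_ge0 k : (0 <= q ^+ k)%R by rewrite exprn_ge0 // ltW.
(* The term [j = 0] is an alignment starting at [v]; the term [j = i.+1] has exactly the weight of
   term [i] in the danger of the parent. *)
apply: (@le_trans _ _ (\sum_(x : X) ((if start v x 0 then q ^+ n x else 0) +
   (if (rank (par v) < rank v)%N then
      \sum_(j < n x) (matched f x j (par v))%:R * q ^+ (n x - j.+1) else 0)))%R).
  apply: ler_sum => x _; case: (n x) (n_gt0 x) => // m _.
  rewrite big_ord_recl; apply: lerD.
    by rewrite /pre andbT; case: ifP => _; rewrite ?mul1r ?mul0r.
  case: ifP => [_|nlt]; last first.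
    rewrite big1 // => j _; rewrite /pre !lift0.
    case s: start; last by rewrite mul0r.
    by rewrite (par_lt s) in nlt.
  rewrite [leRHS]big_ord_recr ler_wpDr ?mulr_ge0 ?ler0n //.
  apply: ler_sum => j _; rewrite /pre !lift0.
  by apply: ler_wpM2r => //; rewrite ler_nat; case: start.
rewrite big_split /= lerD2l; case: ifP => // _.
by rewrite big1.
Qed.

(** If all [K] colours gave danger at least [1], then [q] times the sum would reach [K q >= 2], but
    [sum_danger_recolour] keeps it below [2]. *)
Lemma recolour_danger_lt1 f v (l : seq nat) : uniq l -> size l = K ->
  ((rank (par v) < rank v)%N -> (danger f (par v) < 1)%R) ->
  exists2 a, a \in l & (danger (recolour f v a) v < 1)%R.
Proof.
move=> ul sl ltp; apply: contrapT => nex.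
have ge1 a : a \in l -> (1 <= danger (recolour f v a) v)%R.
  by move=> al; rewrite leNgt; apply/negP => lt1; apply: nex; exists a.
have sum_ge : (K%:R <= \sum_(a <- l) danger (recolour f v a) v)%R.
  rewrite -sl -sum1_size natr_sum big_seq [leRHS]big_seq.
  by apply: ler_sum => a /ge1.
have := sum_danger_recolour f v ul.
have : (K%:R * q <= q * \sum_(a <- l) danger (recolour f v a) v)%R.
  by rewrite mulrC ler_pM2l.
move: Kq; case: ifP => [/ltp|_]; lra.
Qed.

(** Vertices are coloured by increasing rank; danger depends only on colours of rank up to that of
    its vertex, so later choices do not change it. *)
Lemma greedy_colouring (L : V -> seq nat) :
  (forall v, uniq (L v)) -> (forall v, size (L v) = K) ->
  exists2 f : V -> nat, (forall v, f v \in L v) &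
    forall v x, ~~ matched f x (n x).-1 v.
Proof.
move=> uL sL.
suff [f [fL fd]] : exists f : V -> nat, (forall v, f v \in L v) /\
    forall v, (danger f v < 1)%R.
  exists f => // v x; apply/negP => mx; have := fd v; rewrite ltNge => /negP[].
  have lt : (n x).-1 < n x by rewrite prednK.
  have nn g w y (j : 'I_(n y)) : (0 <= (matched g y j w)%:R * q ^+ (n y - j.+1))%R.
    by rewrite mulr_ge0 ?ler0n // exprn_ge0 // ltW.
  rewrite /danger (bigD1 x) //= (bigD1 (Ordinal lt)) //= mx mul1r prednK //.
  rewrite subnn expr0 -addrA ler_wpDr // addr_ge0 ?sumr_ge0 // => y _.
  by rewrite sumr_ge0.
have [N ltN] : exists N, forall v, rank v < N.
  by exists (\max_v rank v).+1 => v; rewrite ltnS leq_bigmax.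
suff [f [fL fd]] : exists f : V -> nat, (forall v, f v \in L v) /\
    forall v, rank v < N -> (danger f v < 1)%R.
  by exists f; split=> // v; apply: fd.
have K0 : 0 < K.
  by rewrite lt0n; apply/eqP => E; move: Kq; rewrite E mul0r; lra.
elim: N {ltN} => [|N [f [fL fd]]].
  by exists (fun v => nth 0 (L v) 0); split=> // v; rewrite mem_nth ?sL.
have [[v Ev]|nv] := pselect (exists v, rank v = N); last first.
  exists f; split=> // v; rewrite ltnS leq_eqVlt => /orP[/eqP Ev|]; last exact: fd.
  by case: nv; exists v.
have [|a al da] := @recolour_danger_lt1 f v (L v) (uL v) (sL v).
  by rewrite Ev; apply: fd.
exists (recolour f v a); split=> u.
  by rewrite /recolour; case: eqP => [->|].
rewrite ltnS leq_eqVlt => /orP[/eqP Eu|ltu].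
  by have -> : u = v by apply: rank_inj; rewrite Ev.
rewrite (@danger_ext _ f) ?fd // => w lew; rewrite /recolour; case: eqP => // Ew.
by have := leq_trans lew (ltnW ltu); move: ltu lew; rewrite Ew Ev; lia.
Qed.

End GreedyColouring.

(** * Repetitions as alignments *)

(* An alignment [inl h] looks for a long run of agreements between a vertex and
   its [h]-th ancestor. An alignment [inr (h, w)] looks for agreements between
   two branches below a common peak: [w] is the bottom of the branch visited
   first, at depth [h - margin h], and depth [s] of the other branch is compared
   with depth [h - s] of this one, for [margin h <= s <= h - margin h]. *)
Section Alignments.

Variables (G : sgraph) (t : rooting G) (M : nat).

(** For [h > 0], [(margin h).+1] is [h / M] rounded up. *)
Definition margin (h : nat) : nat := h.-1 %/ M.

Definition alignment : finType := ('I_#|G|.+1 + 'I_#|G|.+1 * G)%type.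

Definition alignment_size (x : alignment) : nat :=
  match x with
  | inl h => (margin h).+1
  | inr (h, _) => (h - (margin h).*2).+1
  end.

(** In the case [inr], [v] lies [e + j] below the peak and its mate [h - e - j]. The last clause
    compares the children of the peak above [w] and [v]; [M < h] makes [e] positive, so [v] is not
    the peak. *)
Definition aligned (v : G) (x : alignment) (j : nat) : bool :=
  match x with
  | inl h => 0 < h <= dep t v
  | inr (h, w) => let e := margin h in
    [&& M < h, j <= h - e.*2, e + j <= dep t v, h - e <= dep t w,
        iter (e + j) (par t) v == iter (h - e) (par t) w &
        dfs_rank t (iter (h - e).-1 (par t) w) <
        dfs_rank t (iter (e + j).-1 (par t) v)]
  end.

Definition align_mate (v : G) (x : alignment) (j : nat) : G :=
  match x with
  | inl h => iter h (par t) v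
  | inr (_, w) => iter j (par t) w
  end.

Hypothesis M_ge3 : 2 < M.

Lemma margin_bound h : 0 < h -> 3 * margin h < h.
Proof.
move=> h0; have := leq_divM h.-1 M; rewrite -/(margin h) => le.
have : margin h * 3 <= margin h * M by rewrite leq_mul2l M_ge3 orbT.
lia.
Qed.

Lemma margin_gt0 h : M < h -> 0 < margin h.
Proof. by move=> lt; rewrite divn_gt0; lia. Qed.

(** The mate is an ancestor of [v] or lies below a child of the peak that is visited earlier. *)
Lemma align_mate_lt v x j : aligned v x j ->
  dfs_rank t (align_mate v x j) < dfs_rank t v.
Proof.
case: x => [h|[[h lth] w]] /=; first exact: dfs_rank_ancestor.
move=> /and5P[Mh jh ejv ew /andP[/eqP Ep lt]].
have e0 := margin_gt0 Mh; have e3 := @margin_bound h (leq_ltn_trans (leq0n _) Mh).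
have dI := dep_iter_par (@dep_par _ t).
have dw : dep t (iter j (par t) w) = dep t w - j by rewrite dI //; lia.
apply: (@dfs_rank_subtrees _ t (margin h + j).-1 ((h - margin h).-1 - j)).
- lia.
- by rewrite dw; lia.
- rewrite -iterD prednK ?Ep; last by lia.
  by congr (iter _ _ _); lia.
- by rewrite -iterD subnK //; lia.
Qed.

Lemma aligned_par_lt v x j : aligned v x j.+1 ->
  dfs_rank t (par t v) < dfs_rank t v.
Proof.
move=> a; apply: (@dfs_rank_ancestor _ t 1).
by case: x a => [h|[h w]] /=; [|move=> /and5P[_ _ + _ _]]; lia.
Qed.

(* If the shorter leg of the path has [m] edges, then [h - m] agreements of the
   repetition lie on the longer leg, between vertices at distance [h], and the
   others compare depths [s] and [h - s] of the two legs. *)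
Lemma repetition_matched (f : G -> nat) (x0 : G) (p : seq G) (h : nat) :
  0 < h -> size p = h + h -> simple_path p ->
  (forall k, k < h -> f (nth x0 p k) = f (nth x0 p (k + h))) ->
  exists x v,
    matched (par t) aligned align_mate f x (alignment_size x).-1 v.
Proof.
move=> h0 sp pP rep.
have [|i lti [upi dni]] := path_peak t x0 pP; first by lia.
have ltN : h < #|G|.+1.
  have /andP[_ /card_uniqP Ep] := pP.
  by have := max_card (mem p); rewrite Ep sp ltnS; apply: leq_trans; rewrite leq_addl.
pose P := nth x0 p.
have upP k n : k + n <= i -> iter n (par t) (P k) = P (k + n) /\ n <= dep t (P k).
  elim: n k => [|n IHn] k le; first by rewrite addn0.
  have [|d0 E] := upi k; first by lia.
  have [|En dn] := IHn k.+1; first by lia.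
  rewrite iterSr /P E -/(P _) En addSnnS; split=> //.
  by have := dep_par d0; rewrite E -/(P _); lia.
have dnP k n : i + n <= k -> k < size p ->
    iter n (par t) (P k) = P (k - n) /\ n <= dep t (P k).
  elim: n k => [|n IHn] [|k] le ltk; rewrite ?subn0 //; first by lia.
  have [||d0 E] := dni k; [by lia|by lia|].
  have [||En dn] := IHn k; [by lia|by lia|].
  rewrite iterSr /P E -/(P _) En subSS; split=> //.
  by have := dep_par d0; rewrite E -/(P _); lia.
have repE k l : k < h -> l = k + h -> f (P k) = f (P l) by move=> ? ->; apply: rep.
pose H : 'I_#|G|.+1 := Ordinal ltN.
(* The peak has index [i] among [2h] vertices, so the legs have [i] and [2h - i - 1] edges. *)
pose m := minn i (h + h - i.+1).
have [le|lt] := leqP h (M * (h - m)).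
  have ltm : margin h < h - m.
    by rewrite ltn_divLR; lia.
  (* The longer leg is the descending one if [i < h], with vertices at distance [h] below the peak
     from index [i + h] on; otherwise it is the ascending one, and the run starts at [P 0]. *)
  exists (inl H); have [ih|hi] := ltnP i h.
    exists (P (i + h + margin h)); apply: matched_intro => k /= lek.
    have [||Ek dk] := dnP (i + h + margin h) k; [lia|lia|].
    have [||Eh dh] := dnP (i + h + margin h - k) h; [lia|lia|].
    rewrite Ek h0 dh Eh; split=> //; apply/esym/repE; lia.
  exists (P 0); apply: matched_intro => k /= lek.
  have [|Ek dk] := upP 0 k; first lia.
  have [|Eh dh] := upP k h; first lia.
  rewrite Ek h0 dh Eh; split=> //; apply: repE; lia.
(* The legs have [2h - 1] edges together, so [m < h] and [M <= M * (h - m) < h]. *)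
have Mh : M < h by nia.
have lee : h - m <= margin h by rewrite leq_divRL; lia.
have e0 := margin_gt0 Mh; have e3 := margin_bound h0.
set e := margin h in lee e0 e3.
pose l := P (i - (h - e)); pose r := P (i + (h - e)).
have lP n : n <= h - e -> iter n (par t) l = P (i - (h - e) + n) /\ n <= dep t l.
  by move=> len; apply: upP; lia.
have rP n : n <= h - e -> iter n (par t) r = P (i + (h - e) - n) /\ n <= dep t r.
  by move=> len; apply: dnP; lia.
have peak : iter (h - e) (par t) l = iter (h - e) (par t) r.
  by rewrite (lP _ (leqnn _)).1 (rP _ (leqnn _)).1; congr (P _); lia.
have le1 : (h - e).-1 <= h - e by lia.
(* These are the two children of the peak on the path; the one of smaller rank decides which branch
   supplies [w]. *)
have : dfs_rank t (iter (h - e).-1 (par t) l) <> dfs_rank t (iter (h - e).-1 (par t) r).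
  move=> /dfs_rank_inj; rewrite (lP _ le1).1 (rP _ le1).1 => /eqP.
  have /andP[_ up] := pP; rewrite nth_uniq ?sp; [move=> /eqP; lia|lia|lia|by []].
have main u w : iter (h - e) (par t) u = iter (h - e) (par t) w ->
    h - e <= dep t u -> h - e <= dep t w ->
    dfs_rank t (iter (h - e).-1 (par t) w) < dfs_rank t (iter (h - e).-1 (par t) u) ->
    (forall k, k <= h - e.*2 ->
       f (iter k (par t) u) = f (iter (h - e.*2 - k) (par t) w)) ->
    matched (par t) aligned align_mate f (inr (H, w)) (h - e.*2) u.
  move=> Euw du dw lt_uw fuw; apply: matched_intro => k lek; split; last exact: fuw.
  have dk : dep t (iter k (par t) u) = dep t u - k.
    by rewrite (dep_iter_par (@dep_par _ t)) //; lia.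
  rewrite /= -/e Mh dw dk -!iterD.
  have -> : e + (h - e.*2 - k) + k = h - e by lia.
  have -> : (e + (h - e.*2 - k)).-1 + k = (h - e).-1 by lia.
  by rewrite Euw eqxx lt_uw !andbT; lia.
move=> /eqP; rewrite neq_ltn => /orP[lt_lr|lt_rl].
  exists (inr (H, l)), r; apply: main => //.
  - exact: (rP _ (leqnn _)).2.
  - exact: (lP _ (leqnn _)).2.
  - move=> k lek; have [|-> _] := rP k; first by lia.
    have [|-> _] := lP (h - e.*2 - k); first by lia.
    by apply/esym/repE; lia.
exists (inr (H, r)), l; apply: main => //.
- exact: (lP _ (leqnn _)).2.
- exact: (rP _ (leqnn _)).2.
- move=> k lek; have [|-> _] := lP k; first by lia.
  have [|-> _] := rP (h - e.*2 - k); first by lia.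
  by apply: repE; lia.
Qed.

Variables (R : realFieldType) (q : R).
Hypothesis q_gt0 : (0 < q)%R.

(** For given [h] the peak must be the [margin h]-th ancestor of [v], so [card_descendants] bounds
    the choices of [w]. *)
Lemma sum_aligned0 v :
  (\sum_(x | aligned v x 0) q ^+ alignment_size x <=
   \sum_(h < #|G|.+1 | (0 < h)%N) q ^+ (margin h).+1 +
   \sum_(h < #|G|.+1 | (M < h)%N)
      (max_degree G ^ (h - margin h))%:R * q ^+ (h - (margin h).*2).+1)%R.
Proof.
have q_ge0 k : (0 <= q ^+ k)%R by rewrite exprn_ge0 // ltW.
rewrite big_mkcond big_sumType /=; apply: lerD.
  rewrite [leRHS]big_mkcond /=; apply: ler_sum => h _.
  by case: (0 < h) => //=; case: ifP.
rewrite [leRHS]big_mkcond /=.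
pose F (h : 'I_#|G|.+1) (w : G) : R := (if aligned v (inr (h, w)) 0
  then q ^+ alignment_size (inr (h, w)) else 0)%R.
rewrite (eq_bigr (fun p => F p.1 p.2)); last by case.
rewrite -(pair_bigA _ F) /F /=.
apply: ler_sum => h _; case: ifP => Mh; last first.
  by rewrite big1.
rewrite -big_mkcond /= sumr_const -[leLHS]mulr_natl ler_wpM2r //.
rewrite ler_nat; apply: leq_trans (card_descendants t (iter (margin h + 0) (par t) v) _).
apply: subset_leq_card; apply/fintype.subsetP => w.
by rewrite unfold_in !inE => /and4P[_ -> /eqP -> _]; rewrite /= eqxx.
Qed.

Lemma thue_choosable_rooted (K : nat) : (2 <= K%:R * q)%R ->
  (\sum_(h < #|G|.+1 | (0 < h)%N) q ^+ (margin h).+1 +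
   \sum_(h < #|G|.+1 | (M < h)%N)
      (max_degree G ^ (h - margin h))%:R * q ^+ (h - (margin h).*2).+1 <= 1)%R ->
  thue_choosable G K.
Proof.
move=> Kq le1 L KL.
have /choice[l lP] : forall v, exists l : seq nat,
    [/\ uniq l, size l = K & forall a, a \in l -> L v a].
  move=> v; have /pcard_leP[g] := KL v; exists (map g (iota 0 K)); split.
  - rewrite map_inj_in_uniq ?iota_uniq // => i j.
    rewrite !mem_iota /= !add0n => lti ltj.
    by apply: (@inj _ _ _ g); rewrite inE.
  - by rewrite size_map size_iota.
  - by move=> _ /mapP[i + ->]; rewrite mem_iota /= add0n => lti; apply: funS.
have [f fl nf] := greedy_colouring (n := alignment_size) (@dfs_rank_inj _ t)
  align_mate_lt aligned_par_lt (fun x => ltac:(by case: x => [|[]])) q_gt0 Kq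
  (fun v => le_trans (sum_aligned0 v) le1)
  (fun v => let: And3 ul _ _ := lP v in ul)
  (fun v => let: And3 _ sl _ := lP v in sl).
exists f; split=> [v|p /andP[sp up] s sf [x [x0 Es]]].
  by have [_ _] := lP v; apply.
have /infixP[a [b Ep]] := sf.
(* The subpath of [p] that carries the repetition. *)
pose p' := take (size s) (drop (size a) p).
have Ep' : map f p' = x ++ x.
  by rewrite map_take map_drop Ep drop_size_cat // take_size_cat.
have pP : simple_path p'.
  by rewrite /simple_path take_sorted ?drop_sorted // take_uniq ?drop_uniq.
have sp' : size p' = size x + size x by rewrite -(size_map f) Ep' size_cat.
have v0 : G by case: (p') sp' => [|v //]; case: (x) x0.
have [|y [v]] := @repetition_matched f v0 p' (size x) x0 sp' pP.
  move=> k ltk; rewrite -!(nth_map v0 0 f) ?sp' ?ltn_add2r ?Ep'; try lia.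
  by rewrite !nth_cat ltk ltnNge leq_addl /= addnK.
by apply/negP/nf.
Qed.

End Alignments.

(** * Estimates of the starting weights *)

Lemma sum_geometric_third (R : realFieldType) (N : nat) :
  (\sum_(h < N | (0 < h)%N) (3^-1 : R) ^+ h <= 2^-1)%R.
Proof.
have [N0|[n ->]] : N = 0 \/ exists n, N = n.+1 by case: N => [|n]; [left|right; exists n].
  by rewrite N0 big_ord0; lra.
suff -> : (\sum_(h < n.+1 | (0 < h)%N) (3^-1 : R) ^+ h =
           2^-1 - 2^-1 * 3^-1 ^+ n)%R.
  by have : (0 <= (3^-1 : R) ^+ n)%R by [apply: exprn_ge0; lra]; lra.
elim: n => [|n IHn].
  by rewrite big_mkcond big_ord_recl big_ord0 /= expr0; lra.
rewrite big_mkcond big_ord_recr /= -big_mkcond IHn exprS; lra.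
Qed.

Local Open Scope ring_scope.

Lemma natr_powR_ge1 (R : realType) (n : nat) (r : R) :
  (0 < n)%N -> 0 <= r -> 1 <= n%:R `^ r.
Proof. by move=> n0 r0; rewrite -[X in X <= _](powRr0 n%:R) ler_powR ?ler1n. Qed.

Section Weights.

Variables (R : realType) (eps : R) (M D : nat).
Hypothesis eps_gt0 : 0 < eps.
Hypothesis M_ge3 : (2 < M)%N.
Hypothesis M_eps : eps^-1 <= M%:R - 2.
Hypothesis D_gt0 : (0 < D)%N.

(** The power of [D] pays for the choice of a branch; [3 ^+ M] leaves [3^-1 ^+ h] for each [h], so
    that each of the two sums is at most [1/2]. *)
Let q : R := (3 ^+ M * D%:R `^ (1 + eps))^-1.

Let D_ge1 : 1 <= D%:R :> R. Proof. by rewrite ler1n. Qed.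

Let powD_ge1 : 1 <= D%:R `^ (1 + eps) :> R.
Proof. by rewrite natr_powR_ge1 ?addr_ge0 ?ltW. Qed.

Lemma weight_gt0 : 0 < q.
Proof. by rewrite invr_gt0 mulr_gt0 ?exprn_gt0 // (lt_le_trans ltr01). Qed.

Lemma vertical_weight_le h : (0 < h)%N -> q ^+ (margin M h).+1 <= 3^-1 ^+ h.
Proof.
move=> h0; have le : (h <= M * (margin M h).+1)%N.
  by have := divn_eq h.-1 M; have := @ltn_pmod h.-1 M; rewrite -/(margin M h); nia.
apply: (@le_trans _ _ ((3^-1 ^+ M) ^+ (margin M h).+1)).
  apply: lerXn2r; rewrite ?nnegrE ?exprn_ge0 ?(ltW weight_gt0) //.
  rewrite exprVn lef_pV2 ?posrE ?mulr_gt0 ?exprn_gt0 // ?(lt_le_trans ltr01) //.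
  by rewrite ler_peMr ?exprn_ge0.
by rewrite -exprM ler_wiXn2l //; lra.
Qed.

(** From [M e <= h] and [eps^-1 <= M - 2] follows [e <= eps (h - 2 e)], hence
    [h - e <= (1 + eps) n], which absorbs the power of [D]. From [3 e < h] follows [h <= M n], which
    serves the power of [3]. *)
Lemma bent_weight_le h : (M < h)%N ->
  (D ^ (h - margin M h))%:R * q ^+ (h - (margin M h).*2).+1 <= 3^-1 ^+ h.
Proof.
move=> Mh; set e := margin M h; set n := (h - e.*2).+1.
have h0 : (0 < h)%N by lia.
have e3 : (3 * e < h)%N := margin_bound M_ge3 h0.
have eM : (M * e <= h)%N.
  by have := leq_divM h.-1 M; rewrite -/(margin M h) -/e; lia.
have le_pow : D%:R ^+ (h - e) <= (D%:R `^ (1 + eps)) ^+ n :> R.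
  rewrite -!powR_mulrn ?ler0n ?powR_ge0 // -powRrM ler_powR //.
  have -> : n%:R = h%:R - 2 * e%:R + 1 :> R.
    by rewrite /n -natr1 natrB; [rewrite -mul2n natrM|lia].
  rewrite natrB; last by lia.
  have : M%:R * e%:R <= h%:R :> R by rewrite -natrM ler_nat.
  have e0 : 0 <= e%:R :> R by [].
  have : eps^-1 * e%:R <= (M%:R - 2) * e%:R by rewrite ler_wpM2r.
  move=> l1 l2; have l3 : eps^-1 * e%:R <= h%:R - 2 * e%:R by lra.
  have : e%:R <= eps * (h%:R - 2 * e%:R) by rewrite -ler_pdivrMl.
  by move=> l4; rewrite mulrDr mulrDl mul1r mulr1; have := eps_gt0; lra.
have -> : q ^+ n = ((3 ^+ M) ^+ n)^-1 * ((D%:R `^ (1 + eps)) ^+ n)^-1.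
  by rewrite /q -exprVn invfM exprMn !exprVn.
rewrite natrX mulrCA.
apply: (@le_trans _ _ (((3 ^+ M) ^+ n)^-1 * 1)).
  rewrite ler_wpM2l ?invr_ge0 ?exprn_ge0 //.
  by rewrite ler_pdivrMr ?mul1r // exprn_gt0 // (lt_le_trans ltr01).
rewrite mulr1 -exprM -exprVn ler_wiXn2l; lra || nia.
Qed.

Lemma weights_le1 N :
  \sum_(h < N | (0 < h)%N) q ^+ (margin M h).+1 +
  \sum_(h < N | (M < h)%N)
    (D ^ (h - margin M h))%:R * q ^+ (h - (margin M h).*2).+1 <= 1.
Proof.
have third := sum_geometric_third R N.
suff [] : \sum_(h < N | (0 < h)%N) q ^+ (margin M h).+1 <= 2^-1 /\
  \sum_(h < N | (M < h)%N)
    (D ^ (h - margin M h))%:R * q ^+ (h - (margin M h).*2).+1 <= 2^-1 by lra.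
split; apply: le_trans third; first exact/ler_sum/vertical_weight_le.
rewrite big_mkcond [leRHS]big_mkcond /=; apply: ler_sum => h _.
case: ifP => [Mh|_]; last by case: ifP => // _; rewrite exprn_ge0.
by rewrite (leq_ltn_trans (leq0n _) Mh) bent_weight_le.
Qed.

End Weights.

Theorem theorem4 (R : realType) (eps : R) (eps_gt0 : 0 < eps) :
  exists c : R, forall T : sgraph, is_tree T -> (0 < max_degree T)%N ->
    (thue_choice_number T)%:R <= c * (max_degree T)%:R `^ (1 + eps).
Proof.
pose M := (Num.truncn eps^-1).+3.
have M_ge3 : (2 < M)%N by [].
have M_eps : eps^-1 <= M%:R - 2.
  have := truncnS_gt eps^-1; rewrite /M -[in X in _ -> X]natr1 -natr1; lra.
exists (2 * 3 ^+ M + 1) => T /tree_rooting[t] D_gt0.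
set D := max_degree T in D_gt0 *.
have q_gt0 := weight_gt0 M eps_gt0 D_gt0.
have w_le1 := weights_le1 eps_gt0 M_ge3 M_eps D_gt0 #|T|.+1.
set q := (_ * _)^-1 in q_gt0 w_le1.
pose K := (Num.truncn (2 / q)).+1.
have Kq : 2 <= K%:R * q by rewrite -ler_pdivrMr // ltW ?truncnS_gt.
have := thue_choosable_rooted t M_ge3 q_gt0 Kq w_le1.
rewrite /thue_choice_number; case: ex_minnP => k _ kmin /asboolP /kmin leK.
apply: (@le_trans _ _ K%:R); first by rewrite ler_nat.
rewrite /K -natr1 [leRHS]mulrDl mul1r lerD //.
  have /andP[+ _] := truncn_itv (ltW (divr_gt0 (ltr0Sn R 1) q_gt0)).
  by rewrite /q invrK mulrA.
by rewrite natr_powR_ge1 ?addr_ge0 ?ltW.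
Qed.
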